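(* Let $f\in\mathbb L$ be a formal Laurent series over $\mathbb C$ and let $g_1,g_2\in R(f)$ be two inverses of $f$ with $g_1\neq g_2$. Then the set $R(f)$ of all inverses of $f$ is uncountable.
   Context: A formal Laurent series over $\mathbb C$ is a mapping $f:\mathbb Z\to\mathbb C$, written $f=\sum_{n\in\mathbb Z}a_nz^n$ with $a_n=f(n)$ (arbitrarily many nonzero coefficients with negative index are allowed); $\mathbb L$ is the set of all of them. For a sequence $(c_n)_{n\in\mathbb Z}$ of complex numbers, $\sum_{n\in\mathbb Z}c_n:=\sum_{n=1}^\infty c_{-n}+\sum_{n=0}^\infty c_n$, and it is called convergent iff both one-sided series converge. For $g=\sum b_nz^n$, $f=\sum a_nz^n$ in $\mathbb L$, the product is $gf:=\sum_{n\in\mathbb Z}\left(\sum_{m\in\mathbb Z}b_ma_{n-m}\right)z^n$, provided all the sums over $m$ converge; otherwise $gf$ does not exist. $1\in\mathbb L$ denotes the series with coefficients $\delta_{n,0}$. A series $g\in\mathbb L$ is an inverse of $f\in\mathbb L$ iff $fg$ exists and $fg=1$ (equivalently $gf=1$); $R(f)$ denotes the set of all inverses of $f$. *)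

(* Defs.v *)
From HB Require Import structures.
From mathcomp Require Import all_boot all_order all_algebra.
From mathcomp Require Import complex.
From mathcomp Require Import all_classical all_reals all_analysis.

Set Implicit Arguments.
Unset Strict Implicit.
Unset Printing Implicit Defensive.

Import Order.TTheory GRing.Theory Num.Theory.
Import numFieldNormedType.Exports.

Local Open Scope classical_set_scope.
Local Open Scope complex_scope.
Local Open Scope ring_scope.

(* [R[i]] itself carries no topology; its regular module [R[i]^o], a
   convertible alias, is normed by the complex modulus. *)
Definition laurent (R : realType) : Type := int -> R[i]^o.

Definition zsum_cvg (R : realType) (c : int -> R[i]^o) : Prop :=
  cvgn (series (fun n : nat => c (- n.+1%:Z))) /\
  cvgn (series (fun n : nat => c n%:Z)).

(* Meaningful only under [zsum_cvg c]. *)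
Definition zsum (R : realType) (c : int -> R[i]^o) : R[i]^o :=
  limn (series (fun n : nat => c (- n.+1%:Z))) +
  limn (series (fun n : nat => c n%:Z)).

Definition lmul_exists (R : realType) (g f : laurent R) : Prop :=
  forall n : int, zsum_cvg (fun m : int => g m * f (n - m)).

(* Meaningful only under [lmul_exists g f]. *)
Definition lmul (R : realType) (g f : laurent R) : laurent R :=
  fun n : int => zsum (fun m : int => g m * f (n - m)).

Definition lone (R : realType) : laurent R := fun n : int => (n == 0)%:R.

Definition inverses (R : realType) (f : laurent R) : set (laurent R) :=
  [set g | lmul_exists f g /\ lmul f g = lone R].

(* Main.v *)
Require Import Defs.
From mathcomp Require Import all_boot all_order all_algebra.
From mathcomp Require Import all_classical all_reals all_analysis.
From mathcomp Require Import complex ring.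

(** The equation [f g = 1] is linear in [g], so the inverses of [f] form an
    affine subspace of the space of Laurent series: convergence of the two
    one-sided series survives linear combinations, the product [f g] is linear
    in [g] wherever it exists, and hence [a g1 + b g2] inverts [f] as soon as
    [a + b = 1] ([inverses_affine]).  Two distinct inverses therefore span a
    whole line of inverses.  Its points with real parameter are pairwise
    distinct, as one sees on any coefficient where [g1] and [g2] differ, and
    the real line is uncountable because it has infinite Lebesgue measure
    ([uncountable_realType]). *)

Set Implicit Arguments.
Unset Strict Implicit.
Unset Printing Implicit Defensive.

Import Order.TTheory GRing.Theory Num.Theory.
Import numFieldNormedType.Exports.
Local Open Scope classical_set_scope.
Local Open Scope complex_scope.
Local Open Scope ring_scope.

Section SeriesCombination.
Context {K : numFieldType} {V : normedModType K}.
Variables a b : K.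

Lemma series_comb (u v : nat -> V) :
  series (fun n => a *: u n + b *: v n) = a *: series u + b *: series v.
Proof. by rewrite -!seriesZ -seriesD. Qed.

Lemma cvg_series_comb (u v : nat -> V) :
  cvgn (series u) -> cvgn (series v) ->
  cvgn (series (fun n => a *: u n + b *: v n)).
Proof.
by move=> cu cv; rewrite series_comb; apply: is_cvgD; exact: is_cvgZl_tmp.
Qed.

Lemma lim_series_comb (u v : nat -> V) :
  cvgn (series u) -> cvgn (series v) ->
  limn (series (fun n => a *: u n + b *: v n)) =
  a *: limn (series u) + b *: limn (series v).
Proof.
move=> cu cv; rewrite series_comb.
have cau : cvgn (a *: series u) by exact: is_cvgZl_tmp.
have cbv : cvgn (b *: series v) by exact: is_cvgZl_tmp.
by rewrite (limD cau cbv) !limZl_tmp.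
Qed.

End SeriesCombination.

Section AffineCombination.
Variables (R : realType) (a b : R[i]).

Lemma zsum_cvg_comb (c d : int -> R[i]^o) :
  zsum_cvg c -> zsum_cvg d -> zsum_cvg (fun m => a * c m + b * d m : R[i]^o).
Proof.
move=> [cn cp] [dn dp]; split.
(* On the regular module [R[i]^o] the scalar action is the product of [R[i]];
   naming the module lets unification see [*] as [*:]. *)
- exact: (@cvg_series_comb R[i] R[i]^o a b _ _ cn dn).
- exact: (@cvg_series_comb R[i] R[i]^o a b _ _ cp dp).
Qed.

Lemma zsum_comb (c d : int -> R[i]^o) :
  zsum_cvg c -> zsum_cvg d ->
  zsum (fun m => a * c m + b * d m : R[i]^o) = a * zsum c + b * zsum d.
Proof.
move=> [cn cp] [dn dp].
rewrite /zsum (@lim_series_comb R[i] R[i]^o a b _ _ cn dn).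
rewrite (@lim_series_comb R[i] R[i]^o a b _ _ cp dp).
by rewrite !mulrDr addrACA.
Qed.

Definition lcomb (g h : laurent R) : laurent R := fun n => a * g n + b * h n.

Lemma mul_lcomb (f g h : laurent R) (n : int) :
  (fun m => f m * lcomb g h (n - m) : R[i]^o) =
  (fun m => a * (f m * g (n - m)) + b * (f m * h (n - m))).
Proof. by apply/funext => m; rewrite /lcomb mulrDr !(mulrCA (f m)). Qed.

Lemma lmul_exists_comb (f g h : laurent R) :
  lmul_exists f g -> lmul_exists f h -> lmul_exists f (lcomb g h).
Proof.
by move=> fg fh n; rewrite mul_lcomb; exact: zsum_cvg_comb (fg n) (fh n).
Qed.

Lemma lmul_comb (f g h : laurent R) :
  lmul_exists f g -> lmul_exists f h ->
  lmul f (lcomb g h) = lcomb (lmul f g) (lmul f h).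
Proof.
move=> fg fh; apply/funext => n.
by rewrite /lmul mul_lcomb (zsum_comb (fg n) (fh n)).
Qed.

(** The weights enter only through [a (f g) + b (f h) = (a + b) 1]. *)
Lemma inverses_affine (f g h : laurent R) :
  a + b = 1 -> inverses f g -> inverses f h -> inverses f (lcomb g h).
Proof.
move=> ab1 [fg fg1] [fh fh1]; split; first exact: lmul_exists_comb.
rewrite lmul_comb// fg1 fh1; apply/funext => n.
by rewrite /lcomb -mulrDl ab1 mul1r.
Qed.

End AffineCombination.

Lemma uncountable_realType (R : realType) : ~ countable [set: R].
Proof.
move=> /countable_lebesgue_measure0.
by rewrite -set_itvNyy lebesgue_measure_itv.
Qed.

(** On a coefficient where [g] and [h] differ, the point of parameter [t] is
    [g n + t (h n - g n)], which determines [t]. *)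
Lemma lcomb_line_inj (R : realType) (g h : laurent R) : g <> h ->
  injective (fun t : R => lcomb (1 - t%:C) t%:C g h).
Proof.
move=> gh s t est; have [n ghn] : exists n, g n <> h n.
  by apply: contrapT => /forallNP ghE; apply: gh; apply/funext => n;
    exact: contrapT (ghE n).
have /eqP/negPf hgn0 : h n - g n <> 0 by move/subr0_eq => /esym.
have /eqP : (s%:C - t%:C) * (h n - g n : R[i]) = 0.
  move/(congr1 (fun k : laurent R => k n))/eqP: est.
  by rewrite /lcomb -subr_eq0 => /eqP <-; ring.
by rewrite mulf_eq0 hgn0 orbF subr_eq0 => /eqP [].
Qed.

Theorem proposition3p5 (R : realType) (f g1 g2 : laurent R)
    (hg1 : inverses f g1) (hg2 : inverses f g2) (hne : g1 <> g2) :
  ~ countable (inverses f).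
Proof.
move=> /countable_injP[e einj]; apply: (@uncountable_realType R).
apply/countable_injP; exists (e \o fun t : R => lcomb (1 - t%:C) t%:C g1 g2).
have on_line (t : R) : inverses f (lcomb (1 - t%:C) t%:C g1 g2).
  by apply: inverses_affine => //; rewrite subrK.
move=> s t _ _ /= /einj est.
by apply: (lcomb_line_inj hne); apply: est; rewrite inE.
Qed.
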